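(* Let $r\ge1$, let $\boldsymbol{\mu}=(\mu_1,\dots,\mu_r)$ be a system of (possibly complex) measures on $\mathbb{R}$ with all moments finite, let $\boldsymbol{n}\in\mathbb{N}^r$ and $j\in\{1,\dots,r\}$, and assume that $\boldsymbol{n}$ and $\boldsymbol{n}+\boldsymbol{e}_j$ are normal for $\boldsymbol{\mu}$. Let $P_{\boldsymbol{n}}$, $P_{\boldsymbol{n}+\boldsymbol{e}_j}$ be the corresponding type II multiple orthogonal polynomials, and let $W=P_{\boldsymbol{n}+\boldsymbol{e}_j}P_{\boldsymbol{n}}'-P_{\boldsymbol{n}+\boldsymbol{e}_j}'P_{\boldsymbol{n}}$ be their Wronskian. Then $$\{z_0\in\mathbb{C}: W(z_0)=0\}=\{z_0\in\mathbb{C}:\boldsymbol{n}\text{ is not normal for }((x-z_0)^2\mu_1,\dots,(x-z_0)^2\mu_r)\}.$$ In particular, if $P_{\boldsymbol{n}}$ and $P_{\boldsymbol{n}+\boldsymbol{e}_j}$ have real coefficients and $P_{\boldsymbol{n}}$ is real-rooted, then the zeros of $P_{\boldsymbol{n}+\boldsymbol{e}_j}$ and $P_{\boldsymbol{n}}$ interlace if and only if $\boldsymbol{n}$ is normal with respect to $((x-z_0)^2\mu_1,\dots,(x-z_0)^2\mu_r)$ for every $z_0\in\mathbb{R}$.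
   Context: $\mathbb{N}=\{0,1,2,\dots\}$; $|\boldsymbol{n}|=n_1+\dots+n_r$; $\boldsymbol{e}_j$ is the $j$-th standard unit vector. A type II multiple orthogonal polynomial for a system $\boldsymbol{\mu}=(\mu_1,\dots,\mu_r)$ of (possibly complex) measures on $\mathbb{R}$ with finite moments, at $\boldsymbol{n}\in\mathbb{N}^r$, is a monic polynomial $P_{\boldsymbol{n}}$ of exact degree $|\boldsymbol{n}|$ with $\int P_{\boldsymbol{n}}(x)x^k\,d\mu_i(x)=0$ for $k=0,\dots,n_i-1$, $i=1,\dots,r$. The index $\boldsymbol{n}$ is normal for $\boldsymbol{\mu}$ if such a $P_{\boldsymbol{n}}$ exists and is unique. Equivalently, the $|\boldsymbol{n}|\times|\boldsymbol{n}|$ matrix obtained by stacking, for $i=1,\dots,r$, the blocks $\big(\int x^{p+q}d\mu_i(x)\big)_{0\le p\le n_i-1,\,0\le q\le|\boldsymbol{n}|-1}$ has non-zero determinant (the empty determinant being $1$). $(x-z_0)^2\mu$ denotes the measure $\nu$ with $\int f\,d\nu=\int f(x)(x-z_0)^2\,d\mu(x)$. A polynomial is real-rooted if all its complex zeros are real. The zeros of two real polynomials $p,q$ interlace if all zeros of $p$ and of $q$ are real and simple, $p$ and $q$ have no common zero, and between every two consecutive zeros of either one of the polynomials there lies exactly one zero of the other. *)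

(* Defs.v *)
From HB Require Import structures.
From mathcomp Require Import all_boot all_order all_algebra complex.
From mathcomp Require Import all_classical all_reals all_analysis.
From mathcomp Require Import measurable_realfun ring.

Set Implicit Arguments.
Unset Strict Implicit.
Unset Printing Implicit Defensive.

Import Order.TTheory GRing.Theory Num.Theory.
Import numFieldNormedType.Exports.

Local Open Scope classical_set_scope.
Local Open Scope ring_scope.
Local Open Scope complex_scope.

Lemma integrable_le_measure d (T : measurableType d) (R : realType)
    (m1 m2 : {measure set T -> \bar R}) (f : T -> \bar R) :
  (forall A, measurable A -> (m1 A <= m2 A)%E) ->
  m2.-integrable setT f -> m1.-integrable setT f.
Proof.
move=> m12 /integrableP[mf fi]; apply/integrableP; split => //.
apply: le_lt_trans fi; apply: ge0_le_measure_integral => //.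
exact: measurableT_comp.
Qed.

Section SignedMeasures.
Variable R : realType.
Implicit Types (nu : {charge set R -> \bar R}) (w : R -> R).

Lemma hahn_sets_ex nu :
  exists PN : set R * set R, hahn_decomposition nu PN.1 PN.2.
Proof. by have [P [N PN]] := Hahn_decomposition nu; exists (P, N). Qed.

(* The Jordan decomposition does not depend on the Hahn sets that are chosen
   (lemma Hahn_decomposition_uniq). *)
Definition hahn_sets nu := cid (hahn_sets_ex nu).

Definition charge_pos nu : {finite_measure set R -> \bar R} :=
  jordan_pos (projT2 (hahn_sets nu)).

Definition charge_neg nu : {finite_measure set R -> \bar R} :=
  jordan_neg (projT2 (hahn_sets nu)).

Definition total_variation nu : {measure set R -> \bar R} :=
  charge_variation (projT2 (hahn_sets nu)).

Definition charge_integral nu (f : R -> R) : R :=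
  \int[charge_pos nu]_x f x - \int[charge_neg nu]_x f x.

Definition charge_integrable nu (f : R -> R) : Prop :=
  (total_variation nu).-integrable setT (EFin \o f).

Lemma charge_integrable_pos nu w : charge_integrable nu w ->
  (charge_pos nu).-integrable setT (EFin \o w).
Proof.
apply: integrable_le_measure => A mA.
by rewrite /total_variation/= /charge_variation leeDl.
Qed.

Lemma charge_integrable_neg nu w : charge_integrable nu w ->
  (charge_neg nu).-integrable setT (EFin \o w).
Proof.
apply: integrable_le_measure => A mA.
by rewrite /total_variation/= /charge_variation leeDr.
Qed.

(* A |-> \int_A w d nu *)
Definition density_charge nu w (iw : charge_integrable nu w) :
    {charge set R -> \bar R} :=
  cadd (induced_charge (charge_integrable_pos iw))
       (copp (induced_charge (charge_integrable_neg iw))).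

Definition charge_finite_moments nu : Prop :=
  forall k : nat, charge_integrable nu (fun x => x ^+ k).

Lemma charge_integrable_poly nu (p : {poly R}) :
  charge_finite_moments nu -> charge_integrable nu (horner p).
Proof.
move=> hnu; rewrite /charge_integrable.
have -> : EFin \o horner p =
    (fun x => \sum_(i < size p) ((p`_i)%:E * (x ^+ i)%:E))%E.
  apply/funext => x /=; rewrite horner_coef -sumEFin.
  by apply: eq_bigr => i _; rewrite EFinM.
apply: integrable_sum => // i _.
exact: (integrableZl measurableT (p`_i) (hnu i)).
Qed.

End SignedMeasures.

(* A complex measure is given by its real and imaginary parts. *)
Record complex_measure (R : realType) := ComplexMeasure {
  cmRe : {charge set R -> \bar R};
  cmIm : {charge set R -> \bar R} }.

Section ComplexMeasures.
Variable R : realType.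
Implicit Types mu : complex_measure R.

(* |Re mu|, |Im mu| <= |mu| <= |Re mu| + |Im mu|, so this is integrability of
   the powers of x against the total variation of mu. *)
Definition finite_moments mu : Prop :=
  charge_finite_moments (cmRe mu) /\ charge_finite_moments (cmIm mu).

Definition complex_integral mu (f : R -> R[i]) : R[i] :=
  (charge_integral (cmRe mu) (fun x => complex.Re (f x))
     - charge_integral (cmIm mu) (fun x => complex.Im (f x)))
  +i* (charge_integral (cmRe mu) (fun x => complex.Im (f x))
     + charge_integral (cmIm mu) (fun x => complex.Re (f x))).

Definition weight (z0 : R[i]) (x : R) : R[i] := (x%:C - z0) ^+ 2.

Lemma integrable_Re_weight (nu : {charge set R -> \bar R}) z0 :
  charge_finite_moments nu ->
  charge_integrable nu (fun x => complex.Re (weight z0 x)).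
Proof.
move=> hnu; case: z0 => a b.
rewrite (_ : (fun x => _) = horner (('X - a%:P) ^+ 2 - (b ^+ 2)%:P)).
  exact: charge_integrable_poly.
apply/funext => x; rewrite /weight !hornerE /=; ring.
Qed.

Lemma integrable_Im_weight (nu : {charge set R -> \bar R}) z0 :
  charge_finite_moments nu ->
  charge_integrable nu (fun x => complex.Im (weight z0 x)).
Proof.
move=> hnu; case: z0 => a b.
rewrite (_ : (fun x => _) = horner (- (b *+ 2) *: ('X - a%:P))).
  exact: charge_integrable_poly.
apply/funext => x; rewrite /weight !hornerE /=; ring.
Qed.

(* The measure A |-> \int_A (x - z0)^2 d mu(x), by real and imaginary parts. *)
Definition weighted_measure mu (hmu : finite_moments mu) (z0 : R[i]) :
    complex_measure R :=
  ComplexMeasure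
    (cadd (density_charge (integrable_Re_weight z0 hmu.1))
       (copp (density_charge (integrable_Im_weight z0 hmu.2))))
    (cadd (density_charge (integrable_Im_weight z0 hmu.1))
       (density_charge (integrable_Re_weight z0 hmu.2))).

End ComplexMeasures.

Section MultipleOrthogonality.
Variables (R : realType) (r : nat).
Implicit Types (mu : 'I_r -> complex_measure R) (n : 'I_r -> nat).

Definition typeII mu n (P : {poly R[i]}) : Prop :=
  [/\ P \is monic, size P = (\sum_i n i)%N.+1 &
      forall (i : 'I_r) (k : nat), (k < n i)%N ->
        complex_integral (mu i) (fun x => P.[x%:C] * x%:C ^+ k) = 0].

Definition normal mu n : Prop := exists! P : {poly R[i]}, typeII mu n P.

Definition add_unit n (j : 'I_r) : 'I_r -> nat := fun i => (n i + (i == j))%N.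

End MultipleOrthogonality.

Section RealPolynomials.
Variable R : realType.
Implicit Types p q : {poly R}.

Definition complexify p : {poly R[i]} := map_poly (real_complex R) p.

Definition real_rooted p : Prop :=
  forall z : R[i], root (complexify p) z -> exists x : R, z = x%:C.

Definition simple_roots p : Prop := forall x : R, root p x -> mup x p = 1%N.

Definition consecutive_roots p (a b : R) : Prop :=
  [/\ a < b, root p a, root p b & forall c, a < c < b -> ~~ root p c].

Definition separates p q : Prop :=
  forall a b, consecutive_roots p a b -> exists! c, (a < c < b) && root q c.

Definition interlace p q : Prop :=
  [/\ real_rooted p /\ real_rooted q,
      simple_roots p /\ simple_roots q,
      forall x : R, ~~ (root p x && root q x),
      separates p q & separates q p].

End RealPolynomials.

(* Main.v *)
From HB Require Import structures.
Require Import Defs.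
From mathcomp Require Import all_boot all_order all_algebra complex polyrcf.
From mathcomp Require Import all_classical all_reals all_analysis.
From mathcomp Require Import measurable_realfun ring lra zify.
Import Order.TTheory GRing.Theory Num.Theory.
Local Open Scope classical_set_scope.
Local Open Scope ring_scope.
Local Open Scope complex_scope.

(* Write [L_i] for integration against [mu_i]; integrating against
    [(x - z0)^2 mu_i] is [p |-> L_i ((X - z0)^2 p)]. By linear algebra, [n] is
    not normal for the weighted system iff some nonzero [g] of degree less than
    [|n|] makes [(X - z0)^2 g] orthogonal up to [n]. Subtracting multiples of
    [Q = P_(n+e_j)] and [P = P_n] and using normality of [n], such a product is
    [a Q + b P]; and a nontrivial combination has a double zero at [z0] iff
    [W(z0) = 0].

    For real polynomials the interlacing is equivalent to [W] having no real
    zero. If [p, q] interlace, Lagrange interpolation of [p] at the zeros of [q]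
    gives [W = - sum_x c_x l_x^2] where all the [c_x] have the same sign.
    Conversely a [W] without real zeros is negative, which forces zeros of each
    polynomial between any two zeros of the other; it also makes all residues
    of [q / p] negative, so that [Im (q / p)] vanishes only on the real line and
    [q] is real-rooted. *)

(** * Finite measures with a nonnegative density *)

Section Densities.
Local Set Implicit Arguments.
Local Unset Strict Implicit.
Context {d : measure_display} {T : measurableType d} {R : realType}.

Lemma jordan_pos_setI (nu : {charge set T -> \bar R}) (P N : set T)
    (nuPN : hahn_decomposition nu P N) (A : set T) :
  measurable A -> jordan_pos nuPN A = nu (A `&` P).
Proof.
by move=> mA; rewrite jordan_posE cjordan_posE /crestr0 mem_set.
Qed.

(** The charge induced by [w] is nonnegative, so [setT] and [set0] form a Hahn decomposition and its
    positive Jordan part is the charge itself, now as a finite measure. *)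
Lemma finite_measure_density_ex (m : {measure set T -> \bar R}) (w : T -> R) :
  (forall x, 0 <= w x) -> m.-integrable setT (EFin \o w) ->
  exists n : {finite_measure set T -> \bar R},
    forall A, measurable A -> n A = (\int[m]_(x in A) (w x)%:E)%E.
Proof.
move=> w0 iw; pose nu : {charge set T -> \bar R} := induced_charge iw.
have nuPN : hahn_decomposition nu setT set0.
  split; last 2 first.
  - by rewrite setU0.
  - by rewrite setI0.
  - split => // A mA _; apply: integral_ge0 => x _ /=; exact: w0.
  - split => // A mA; rewrite subset0 => ->.
    by rewrite charge0.
exists (jordan_pos nuPN) => A mA.
by rewrite [LHS](jordan_pos_setI nuPN mA) setIT.
Qed.

(** [n] is dominated by [m], and its Radon-Nikodym derivative has the same integral as [w] over
    every measurable set, hence equals [w] almost everywhere; the rest is change of variables. *)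
Lemma ge0_integral_density (n m : {finite_measure set T -> \bar R})
    (w : T -> R) (f : T -> \bar R) :
  (forall x, 0 <= w x) -> m.-integrable setT (EFin \o w) ->
  (forall A, measurable A -> n A = (\int[m]_(x in A) (w x)%:E)%E) ->
  (forall x, 0 <= f x)%E -> measurable_fun setT f ->
  (\int[n]_x f x = \int[m]_x (f x * (w x)%:E))%E.
Proof.
move=> w0 iw nE f0 mf.
have nm : n `<< m.
  apply/null_content_dominatesP => A mA mA0; rewrite nE//.
  apply: null_set_integral => //.
  by apply: (measurable_funS measurableT) => //; exact: measurable_int iw.
rewrite -(Radon_Nikodym_SigmaFinite.change_of_variables nm)//.
have iRN := Radon_Nikodym_SigmaFinite.f_integrable nm.
have mw := measurable_int _ iw.
apply: ge0_ae_eq_integral => //.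
- by apply: emeasurable_funM => //; exact: measurable_int iRN.
- exact: emeasurable_funM.
- by move=> x _; rewrite mule_ge0//; exact: Radon_Nikodym_SigmaFinite.f_ge0.
- by move=> x _; rewrite mule_ge0// lee_fin.
have : ae_eq m setT (Radon_Nikodym_SigmaFinite.f n m) (EFin \o w).
  apply: integral_ae_eq => // E _ mE.
  by rewrite -Radon_Nikodym_SigmaFinite.f_integral// nE.
by apply: filterS => x /= /(_ I) ->.
Qed.

Lemma integrable_density (n m : {finite_measure set T -> \bar R})
    (w : T -> R) (f : T -> R) :
  (forall x, 0 <= w x) -> m.-integrable setT (EFin \o w) ->
  (forall A, measurable A -> n A = (\int[m]_(x in A) (w x)%:E)%E) ->
  measurable_fun setT f -> m.-integrable setT (EFin \o (fun x => f x * w x)) ->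
  n.-integrable setT (EFin \o f).
Proof.
move=> w0 iw nE mf /integrableP[_ ifw].
have mEf : measurable_fun setT (EFin \o f) by exact/measurable_EFinP.
apply/integrableP; split => //.
rewrite (ge0_integral_density _ _ nE)//; last exact: measurableT_comp.
apply: le_lt_trans ifw; rewrite le_eqVlt; apply/orP; left; apply/eqP.
by apply: eq_integral => x _ /=; rewrite -EFinM normrM (ger0_norm (w0 x)).
Qed.

Lemma Rintegral_density (n m : {finite_measure set T -> \bar R})
    (w : T -> R) (f : T -> R) :
  (forall x, 0 <= w x) -> m.-integrable setT (EFin \o w) ->
  (forall A, measurable A -> n A = (\int[m]_(x in A) (w x)%:E)%E) ->
  measurable_fun setT f -> m.-integrable setT (EFin \o (fun x => f x * w x)) ->
  \int[n]_x f x = \int[m]_x (f x * w x).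
Proof.
move=> w0 iw nE mf ifw; congr fine.
have mEf : measurable_fun setT (EFin \o f) by exact/measurable_EFinP.
rewrite [LHS]integralE [RHS]integralE.
rewrite !(ge0_integral_density _ _ nE)//; last 2 first.
- exact: measurable_funeneg.
- exact: measurable_funepos.
(* As [w] is nonnegative, [(f w)^+ = f^+ w] and [(f w)^- = f^- w]. *)
congr (_ - _)%E; apply: eq_integral => x _.
  by rewrite !funeposE EFinM maxe_pMl ?lee_fin// mul0e.
by rewrite !funenegE EFinM -mulNe maxe_pMl ?lee_fin// mul0e.
Qed.

End Densities.

(** * Integration against signed measures *)

Section ChargeIntegrals.
Local Set Implicit Arguments.
Local Unset Strict Implicit.
Context {R : realType}.
Implicit Types (nu : {charge set R -> \bar R}) (f w : R -> R).

Lemma charge_jordan nu A : measurable A ->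
  nu A = (charge_pos nu A - charge_neg nu A)%E.
Proof.
move=> mA; rewrite (jordan_decomp (projT2 (hahn_sets nu)) mA).
by rewrite /cadd /= cscaleN1.
Qed.

(* On the positive Hahn set [P], [pos A = nu (A `&` P) <= m1 (A `&` P)]: the
   Jordan decomposition is the smallest splitting of [nu]. *)
Lemma charge_pos_le nu (m1 m2 : {measure set R -> \bar R}) :
  (forall A, measurable A -> nu A = m1 A - m2 A)%E ->
  forall A, measurable A -> (charge_pos nu A <= m1 A)%E.
Proof.
move=> nuE A mA; have [[mP _] _ _ _] := projT2 (hahn_sets nu).
rewrite [leLHS](jordan_pos_setI (projT2 (hahn_sets nu)) mA).
have mAP := measurableI _ _ mA mP.
rewrite nuE//; apply: (@le_trans _ _ (m1 (A `&` (projT1 (hahn_sets nu)).1))).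
  by apply: geeDl; rewrite oppe_le0.
by apply: le_measure; rewrite ?inE//; exact: subIsetl.
Qed.

(** All four values are finite, so [pos - neg = m1 - m2] can be rearranged. The additive form is an
    equality of measures, which can be integrated. *)
Lemma charge_splitting nu (m1 m2 : {measure set R -> \bar R}) :
  (forall A, measurable A -> nu A = m1 A - m2 A)%E ->
  forall A, measurable A -> (charge_pos nu A + m2 A = m1 A + charge_neg nu A)%E.
Proof.
move=> nuE A mA.
have : nu A \is a fin_num by exact: fin_num_measure.
rewrite nuE// fin_numB => /andP[f1 f2].
have := charge_jordan nu mA; rewrite nuE//.
have : charge_pos nu A \is a fin_num by exact: fin_num_measure.
have : charge_neg nu A \is a fin_num by exact: fin_num_measure.
move: (m1 A) (m2 A) f1 f2 (charge_pos nu A) (charge_neg nu A).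
move=> [a| |] [b| |] // _ _ [c| |] [e| |] // _ _ [] h.
by congr (_%:E); lra.
Qed.

Lemma charge_neg_le nu (m1 m2 : {measure set R -> \bar R}) :
  (forall A, measurable A -> nu A = m1 A - m2 A)%E ->
  forall A, measurable A -> (charge_neg nu A <= m2 A)%E.
Proof.
move=> nuE A mA.
have : nu A \is a fin_num by exact: fin_num_measure.
rewrite nuE// fin_numB => /andP[f1 f2].
have := charge_pos_le nuE mA; have := charge_splitting nuE mA.
have : charge_pos nu A \is a fin_num by exact: fin_num_measure.
have : charge_neg nu A \is a fin_num by exact: fin_num_measure.
move: (m1 A) (m2 A) f1 f2 (charge_pos nu A) (charge_neg nu A).
move=> [a| |] [b| |] // _ _ [c| |] [e| |] // _ _ [] h.
rewrite !lee_fin; lra.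
Qed.

Lemma integrable_measure_add (m1 m2 : {measure set R -> \bar R}) f :
  m1.-integrable setT (EFin \o f) -> m2.-integrable setT (EFin \o f) ->
  (measure_add m1 m2).-integrable setT (EFin \o f).
Proof.
move=> /integrableP[mf f1] /integrableP[_ f2]; apply/integrableP; split => //.
rewrite ge0_integral_measure_add//; last exact: measurableT_comp.
exact: lte_add_pinfty.
Qed.

Lemma Rintegral_measure_add (m1 m2 : {measure set R -> \bar R}) f :
  m1.-integrable setT (EFin \o f) -> m2.-integrable setT (EFin \o f) ->
  \int[measure_add m1 m2]_x f x = \int[m1]_x f x + \int[m2]_x f x.
Proof.
move=> i1 i2; rewrite /Rintegral integral_measure_add//.
by rewrite fineD//; exact: integrable_fin_num.
Qed.

Lemma charge_integrable_diff nu (m1 m2 : {measure set R -> \bar R}) f :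
  (forall A, measurable A -> nu A = m1 A - m2 A)%E ->
  m1.-integrable setT (EFin \o f) -> m2.-integrable setT (EFin \o f) ->
  charge_integrable nu f.
Proof.
move=> nuE i1 i2.
apply: (@integrable_le_measure _ _ _ _ (measure_add m1 m2)).
  move=> A mA; rewrite [leRHS](measure_addE m1 m2); apply: leeD.
    exact: charge_pos_le nuE _ mA.
  exact: charge_neg_le nuE _ mA.
exact: integrable_measure_add.
Qed.

(** The measures [pos + m2] and [m1 + neg] agree, so [f] has the same integral against both. Thus
    integrals against sums, opposites and densities can be computed without finding their Hahn
    sets. *)
Lemma charge_integral_diff nu (m1 m2 : {measure set R -> \bar R}) f :
  (forall A, measurable A -> nu A = m1 A - m2 A)%E ->
  m1.-integrable setT (EFin \o f) -> m2.-integrable setT (EFin \o f) ->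
  charge_integral nu f = \int[m1]_x f x - \int[m2]_x f x.
Proof.
move=> nuE i1 i2; have inu := charge_integrable_diff nuE i1 i2.
have ip := charge_integrable_pos inu; have ineg := charge_integrable_neg inu.
have : \int[measure_add (charge_pos nu) m2]_x f x =
       \int[measure_add m1 (charge_neg nu)]_x f x.
  congr fine; apply: eq_measure_integral => A mA _.
  rewrite [LHS](measure_addE (charge_pos nu) m2).
  by rewrite [RHS](measure_addE m1 (charge_neg nu)); exact: charge_splitting.
by rewrite !Rintegral_measure_add// /charge_integral; lra.
Qed.

Lemma charge_integralD nu f g : charge_integrable nu f ->
  charge_integrable nu g ->
  charge_integral nu (fun x => f x + g x) =
  charge_integral nu f + charge_integral nu g.
Proof.
move=> intf intg; rewrite /charge_integral !RintegralD//; first by ring.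
all: by [exact: charge_integrable_pos | exact: charge_integrable_neg].
Qed.

Lemma charge_integrableZl nu f a :
  charge_integrable nu f -> charge_integrable nu (fun x => a * f x).
Proof. by move=> i; exact: (integrableZl measurableT a i). Qed.

Lemma charge_integralZl nu f a : charge_integrable nu f ->
  charge_integral nu (fun x => a * f x) = a * charge_integral nu f.
Proof.
move=> intf; rewrite /charge_integral !RintegralZl//; first by ring.
all: by [exact: charge_integrable_pos | exact: charge_integrable_neg].
Qed.

Lemma charge_integrable_cadd nu1 nu2 f : charge_integrable nu1 f ->
  charge_integrable nu2 f -> charge_integrable (cadd nu1 nu2) f /\
  charge_integral (cadd nu1 nu2) f = charge_integral nu1 f + charge_integral nu2 f.
Proof.
move=> i1 i2; pose m1 := measure_add (charge_pos nu1) (charge_pos nu2).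
pose m2 := measure_add (charge_neg nu1) (charge_neg nu2).
have addE (A : set R) : measurable A -> cadd nu1 nu2 A = (m1 A - m2 A)%E.
  move=> mA; rewrite [m1 A]measure_addE [m2 A]measure_addE.
  rewrite [cadd nu1 nu2 A]/= /cadd [in LHS](charge_jordan nu1 mA).
  rewrite (charge_jordan nu2 mA) oppeD ?fin_num_adde_defl//.
    by rewrite addeACA.
  exact: fin_num_measure.
have [p1 p2] := (charge_integrable_pos i1, charge_integrable_pos i2).
have [n1 n2] := (charge_integrable_neg i1, charge_integrable_neg i2).
have im1 := integrable_measure_add p1 p2.
have im2 := integrable_measure_add n1 n2.
split; first exact: charge_integrable_diff addE im1 im2.
rewrite (charge_integral_diff addE im1 im2) !Rintegral_measure_add//.
by rewrite /charge_integral; ring.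
Qed.

Lemma charge_integrable_copp nu f : charge_integrable nu f ->
  charge_integrable (copp nu) f /\
  charge_integral (copp nu) f = - charge_integral nu f.
Proof.
move=> i; have ip := charge_integrable_pos i; have im := charge_integrable_neg i.
have oppE (A : set R) : measurable A ->
    copp nu A = (charge_neg nu A - charge_pos nu A)%E.
  move=> mA; rewrite -[LHS]/(- nu A)%E (charge_jordan nu mA).
  by rewrite fin_num_oppeB ?fin_num_measure// addeC.
split; first exact: charge_integrable_diff oppE im ip.
by rewrite (charge_integral_diff oppE im ip) /charge_integral opprB.
Qed.

(** The densities [w^+] and [w^-] give finite measures whose difference is the induced charge, a
    splitting to which [charge_integral_diff] applies. *)
Lemma charge_integrable_induced (m : {finite_measure set R -> \bar R}) w
    (iw : m.-integrable setT (EFin \o w)) f :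
  measurable_fun setT f -> m.-integrable setT (EFin \o (fun x => f x * w x)) ->
  charge_integrable (induced_charge iw) f /\
  charge_integral (induced_charge iw) f = \int[m]_x (f x * w x).
Proof.
move=> mf ifw.
have ip := integrable_funrpos measurableT iw.
have im := integrable_funrneg measurableT iw.
have mw : measurable_fun setT w by apply/measurable_EFinP; exact: measurable_int iw.
(* Both [|f w^+|] and [|f w^-|] are bounded by [|f w|]. *)
have ifp : m.-integrable setT (EFin \o (fun x => f x * w^\+ x)).
  apply: le_integrable ifw => //.
    apply/measurable_EFinP; apply: measurable_funM => //.
    exact: measurable_funrpos.
  move=> x _ /=; rewrite lee_fin !normrM ler_wpM2l// ger0_norm//.
  by rewrite ge_max normr_ge0 ler_norm.
have ifm : m.-integrable setT (EFin \o (fun x => f x * w^\- x)).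
  apply: le_integrable ifw => //.
    apply/measurable_EFinP; apply: measurable_funM => //.
    exact: measurable_funrneg.
  move=> x _ /=; rewrite lee_fin !normrM ler_wpM2l// ger0_norm//.
  by rewrite ge_max normr_ge0 -normrN ler_norm.
have [n1 n1E] := finite_measure_density_ex (funrpos_ge0 w) ip.
have [n2 n2E] := finite_measure_density_ex (funrneg_ge0 w) im.
have indE (A : set R) : measurable A -> induced_charge iw A = (n1 A - n2 A)%E.
  move=> mA; rewrite n1E// n2E// -integralB//; last 2 first.
  - exact: integrableS ip.
  - exact: integrableS im.
  apply: eq_integral => x _ /=; rewrite -EFinB; congr EFin.
  by rewrite -[in LHS](funrposBneg w).
have i1 := integrable_density (funrpos_ge0 w) ip n1E mf ifp.
have i2 := integrable_density (funrneg_ge0 w) im n2E mf ifm.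
split; first exact: charge_integrable_diff indE i1 i2.
rewrite (charge_integral_diff indE i1 i2).
rewrite (Rintegral_density (funrpos_ge0 w) ip n1E mf ifp).
rewrite (Rintegral_density (funrneg_ge0 w) im n2E mf ifm).
rewrite -RintegralB//; apply: eq_Rintegral => x _.
by rewrite -mulrBr -[in RHS](funrposBneg w).
Qed.

Lemma charge_integrable_density nu w (iw : charge_integrable nu w) f :
  measurable_fun setT f -> charge_integrable nu (fun x => f x * w x) ->
  charge_integrable (density_charge iw) f /\
  charge_integral (density_charge iw) f = charge_integral nu (fun x => f x * w x).
Proof.
move=> mf ifw.
have [i1 e1] := charge_integrable_induced (charge_integrable_pos iw) mf
  (charge_integrable_pos ifw).
have [i2 e2] := charge_integrable_induced (charge_integrable_neg iw) mf
  (charge_integrable_neg ifw).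
have [i3 e3] := charge_integrable_copp i2.
have [i4 e4] := charge_integrable_cadd i1 i3.
by split=> //; rewrite [LHS]e4 e3 e1 e2.
Qed.

End ChargeIntegrals.

(** * Complex polynomials integrated against complex measures *)

Section PolynomialIntegrals.
Local Set Implicit Arguments.
Local Unset Strict Implicit.
Context {R : realType}.
Implicit Types (nu : {charge set R -> \bar R}) (mu : complex_measure R)
  (p q : {poly R[i]}).

Lemma Re_horner p (x : R) :
  complex.Re p.[x%:C] = (map_poly (@complex.Re R) p).[x].
Proof.
rewrite [RHS](horner_coef_wide _ (size_poly _ _)) horner_coef raddf_sum/=.
apply: eq_bigr => i _; rewrite coef_map/= -rmorphXn/=.
by case: (p`_i) => a b /=; rewrite mulr0 subr0.
Qed.

Lemma Im_horner p (x : R) :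
  complex.Im p.[x%:C] = (map_poly (@complex.Im R) p).[x].
Proof.
rewrite [RHS](horner_coef_wide _ (size_poly _ _)) horner_coef raddf_sum/=.
apply: eq_bigr => i _; rewrite coef_map/= -rmorphXn/=.
by case: (p`_i) => a b /=; rewrite mulr0 add0r.
Qed.

Lemma charge_integrable_Re nu p : charge_finite_moments nu ->
  charge_integrable nu (fun x => complex.Re p.[x%:C]).
Proof.
move=> hnu; rewrite (_ : (fun x => _) = horner (map_poly (@complex.Re R) p)).
  exact: charge_integrable_poly.
by apply/funext => x; exact: Re_horner.
Qed.

Lemma charge_integrable_Im nu p : charge_finite_moments nu ->
  charge_integrable nu (fun x => complex.Im p.[x%:C]).
Proof.
move=> hnu; rewrite (_ : (fun x => _) = horner (map_poly (@complex.Im R) p)).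
  exact: charge_integrable_poly.
by apply/funext => x; exact: Im_horner.
Qed.

Lemma measurable_charge_integrable nu (f : R -> R) :
  charge_integrable nu f -> measurable_fun setT f.
Proof. by move=> i; apply/measurable_EFinP; exact: measurable_int i. Qed.

Definition poly_integral mu p : R[i] := complex_integral mu (fun x => p.[x%:C]).

Lemma poly_integralD mu p q : finite_moments mu ->
  poly_integral mu (p + q) = poly_integral mu p + poly_integral mu q.
Proof.
move=> [h1 h2]; rewrite /poly_integral /complex_integral.
have ReD : (fun x : R => complex.Re (p + q).[x%:C]) =
    (fun x => complex.Re p.[x%:C] + complex.Re q.[x%:C]).
  by apply/funext => x; rewrite hornerD raddfD.
have ImD : (fun x : R => complex.Im (p + q).[x%:C]) =
    (fun x => complex.Im p.[x%:C] + complex.Im q.[x%:C]).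
  by apply/funext => x; rewrite hornerD raddfD.
rewrite ReD ImD !charge_integralD;
  do ?[exact: charge_integrable_Re | exact: charge_integrable_Im].
by apply/eqP; rewrite eq_complex /=; apply/andP; split; apply/eqP; ring.
Qed.

Lemma poly_integralZ mu (c : R[i]) p : finite_moments mu ->
  poly_integral mu (c *: p) = c * poly_integral mu p.
Proof.
move=> [h1 h2]; case: c => a b.
rewrite /poly_integral /complex_integral.
have ReZ : (fun x : R => complex.Re ((a +i* b) *: p).[x%:C]) =
    (fun x => a * complex.Re p.[x%:C] + - b * complex.Im p.[x%:C]).
  by apply/funext => x; rewrite hornerZ; case: (p.[_]) => u v /=; ring.
have ImZ : (fun x : R => complex.Im ((a +i* b) *: p).[x%:C]) =
    (fun x => a * complex.Im p.[x%:C] + b * complex.Re p.[x%:C]).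
  by apply/funext => x; rewrite hornerZ; case: (p.[_]) => u v /=; ring.
rewrite ReZ ImZ !charge_integralD ?charge_integralZl;
  do ?[exact: charge_integrable_Re | exact: charge_integrable_Im |
       exact/charge_integrableZl/charge_integrable_Re |
       exact/charge_integrableZl/charge_integrable_Im].
by apply/eqP; rewrite eq_complex /=; apply/andP; split; apply/eqP; ring.
Qed.

Lemma poly_integral_weighted mu (hmu : finite_moments mu) (z0 : R[i]) p :
  poly_integral (weighted_measure hmu z0) p =
  poly_integral mu (('X - z0%:P) ^+ 2 * p).
Proof.
have [h1 h2] := hmu; rewrite /poly_integral /complex_integral /weighted_measure /=.
pose w : {poly R[i]} := ('X - z0%:P) ^+ 2.
have wE x : weight z0 x = w.[x%:C] by rewrite /weight /w !hornerE.
have Rw : (fun x => complex.Re (weight z0 x)) = horner (map_poly (@complex.Re R) w).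
  by apply/funext => x; rewrite wE Re_horner.
have Iw : (fun x => complex.Im (weight z0 x)) = horner (map_poly (@complex.Im R) w).
  by apply/funext => x; rewrite wE Im_horner.
have Rp : (fun x : R => complex.Re p.[x%:C]) = horner (map_poly (@complex.Re R) p).
  by apply/funext => x; rewrite Re_horner.
have Ip : (fun x : R => complex.Im p.[x%:C]) = horner (map_poly (@complex.Im R) p).
  by apply/funext => x; rewrite Im_horner.
(* The real and imaginary parts of the weight are real polynomials [t]; a density [t] multiplies the
   integrand by [t]. *)
have dE nu (hnu : charge_finite_moments nu) (v : R -> R) (u t : {poly R})
    (iv : charge_integrable nu v) : v = horner t ->
    charge_integrable (density_charge iv) (horner u) /\
    charge_integral (density_charge iv) (horner u) =
    charge_integral nu (horner (u * t)).
  move=> vE; have e : horner (u * t) = (fun x => u.[x] * v x).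
    by apply/funext => x; rewrite hornerM vE.
  rewrite e; apply: charge_integrable_density.
    exact: measurable_charge_integrable (charge_integrable_poly u hnu).
  by rewrite -e; exact: charge_integrable_poly.
have hR1 := fun u => dE _ h1 _ u _ (integrable_Re_weight z0 hmu.1) Rw.
have hI1 := fun u => dE _ h1 _ u _ (integrable_Im_weight z0 hmu.1) Iw.
have hR2 := fun u => dE _ h2 _ u _ (integrable_Re_weight z0 hmu.2) Rw.
have hI2 := fun u => dE _ h2 _ u _ (integrable_Im_weight z0 hmu.2) Iw.
have c1 u := charge_integrable_cadd (hR1 u).1 (charge_integrable_copp (hI2 u).1).1.
have c2 u := charge_integrable_cadd (hI1 u).1 (hR2 u).1.
have opp u := (charge_integrable_copp (hI2 u).1).2.
rewrite Rp Ip !(c1 _).2 !(c2 _).2 !(opp _) !(hR1 _).2 !(hI1 _).2 !(hR2 _).2 !(hI2 _).2.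
set rp := map_poly (@complex.Re R) p; set ip := map_poly (@complex.Im R) p.
set rw := map_poly (@complex.Re R) w; set iw := map_poly (@complex.Im R) w.
(* The difference is written with [-1 *] so that [charge_integralD] and [charge_integralZl] split
   it. *)
have Rwp : (fun x : R => complex.Re (w * p).[x%:C]) =
    (fun x => (rp * rw).[x] + -1 * (ip * iw).[x]).
  apply/funext => x; rewrite (hornerM w p) (hornerM rp rw) (hornerM ip iw).
  rewrite -[rp.[x]]Re_horner -[ip.[x]]Im_horner -[rw.[x]]Re_horner -[iw.[x]]Im_horner.
  by case: (w.[x%:C]) => a b; case: (p.[x%:C]) => c d /=; ring.
have Iwp : (fun x : R => complex.Im (w * p).[x%:C]) =
    (fun x => (rp * iw).[x] + (ip * rw).[x]).
  apply/funext => x; rewrite (hornerM w p) (hornerM rp iw) (hornerM ip rw).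
  rewrite -[rp.[x]]Re_horner -[ip.[x]]Im_horner -[rw.[x]]Re_horner -[iw.[x]]Im_horner.
  by case: (w.[x%:C]) => a b; case: (p.[x%:C]) => c d /=; ring.
rewrite Rwp Iwp.
have iP nu u : charge_finite_moments nu -> charge_integrable nu (horner u).
  by move=> hnu; exact: charge_integrable_poly.
rewrite !charge_integralD ?charge_integralZl;
  do ?[exact: iP | exact/charge_integrableZl/iP].
by apply/eqP; rewrite eq_complex /=; apply/andP; split; apply/eqP; ring.
Qed.

End PolynomialIntegrals.

(** * Orthogonality with respect to abstract linear functionals *)

Section Orthogonality.
Local Set Implicit Arguments.
Local Unset Strict Implicit.
Context {F : fieldType} {r : nat} (L : 'I_r -> {scalar {poly F}}).
Implicit Types (n : 'I_r -> nat) (p q g : {poly F}).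

Definition orthogonal_upto n p : Prop :=
  forall (i : 'I_r) (k : nat), (k < n i)%N -> L i (p * 'X^k) = 0.

Definition monic_orthogonal n p : Prop :=
  [/\ p \is monic, size p = (\sum_i n i)%N.+1 & orthogonal_upto n p].

Lemma orthogonal_uptoD n p q : orthogonal_upto n p -> orthogonal_upto n q ->
  orthogonal_upto n (p + q).
Proof. by move=> hp hq i k ki; rewrite mulrDl linearD hp// hq// addr0. Qed.

Lemma orthogonal_uptoZ n a p : orthogonal_upto n p -> orthogonal_upto n (a *: p).
Proof. by move=> hp i k ki; rewrite -scalerAl linearZ /= hp// mulr0. Qed.

(** This is a square linear system: the [N] lower coefficients of a monic polynomial of degree [N]
    must meet [N] conditions, so unique solvability amounts to a trivial kernel. *)
Lemma monic_orthogonal_uniqueP n :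
  (exists! p, monic_orthogonal n p) <->
  (forall g, (size g <= \sum_i n i)%N -> orthogonal_upto n g -> g = 0).
Proof.
set N := (\sum_i n i)%N; split.
- move=> [p [[pm ps po] pu]] g gs go.
  have spg : (size g < size p)%N by rewrite ps ltnS.
  have : p + g = p.
    apply/esym/pu; split; last exact: orthogonal_uptoD.
    - by rewrite monicE lead_coefDl// -monicE.
    - by rewrite size_polyDl.
  by move/eqP; rewrite -subr_eq0 addrAC subrr add0r => /eqP.
- move=> triv.
  (* The pairs [(i, k)] with [k < n i] index the orthogonality conditions; there are [N] of them. *)
  pose T := {i : 'I_r & 'I_(n i)}.
  have cT : #|{: T}| = N.
    rewrite card_tagged sumnE big_map big_enum/=.
    by apply: eq_bigr => i _; rewrite card_ord.
  pose cond (t : 'I_#|{: T}|) : T := enum_val t.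
  pose ev g : 'rV[F]_#|{: T}| :=
    \row_t L (tag (cond t)) (g * 'X^(tagged (cond t))).
  have ev0 g : ev g = 0 -> orthogonal_upto n g.
    move=> /rowP ev0 i k ki.
    have := ev0 (enum_rank (Tagged (fun i => 'I_(n i)) (Ordinal ki) : T)).
    by rewrite !mxE /cond enum_rankK.
  pose A : 'M[F]_(N, #|{: T}|) := \matrix_(m < N) ev 'X^m.
  have evE (u : 'rV[F]_N) : ev (rVpoly u) = u *m A.
    apply/rowP => t; rewrite !mxE {1}/rVpoly poly_def mulr_suml linear_sum/=.
    apply: eq_bigr => m _; rewrite insubT// => ?.
    by rewrite -scalerAl linearZ /= !mxE; congr (u _ _ * _); apply/val_inj.
  have freeA : row_free A.
    apply: inj_row_free => u; rewrite -evE => /ev0 uo.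
    by rewrite -[u]rVpolyK (triv _ _ uo) ?linear0// size_poly.
  (* [A] is square, so injectivity gives surjectivity; [u] is then chosen so that [rVpoly u] has the
     same values under the functionals as ['X^N]. *)
  have fullA : row_full A by rewrite /row_full (eqP freeA) cT.
  have /submxP [u uE] := submx_full (ev 'X^N) fullA.
  have us : (size (rVpoly u) < N.+1)%N by rewrite ltnS size_poly.
  have po : orthogonal_upto n ('X^N - rVpoly u).
    apply: ev0; apply/rowP => t; have /rowP/(_ t) := uE.
    by rewrite -evE !mxE mulrBl linearB /= => ->; rewrite subrr.
  have ps : size ('X^N - rVpoly u) = N.+1.
    by rewrite size_polyDl size_polyXn ?size_polyN.
  have pm : 'X^N - rVpoly u \is monic.
    by rewrite monicE lead_coefDl ?lead_coefXn// size_polyN size_polyXn.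
  exists ('X^N - rVpoly u); split => // q [qm qs qo].
  apply/eqP; rewrite -subr_eq0; apply/eqP/triv.
    (* Both polynomials are monic of degree [N], so the top coefficient of the difference
       cancels. *)
    have : (size ('X^N - rVpoly u - q)%R <= N.+1)%N.
      by rewrite (leq_trans (size_polyD _ _))// size_polyN qs ps maxnn.
    rewrite leq_eqVlt ltnS => /orP[/eqP e|//].
    exfalso; have := lead_coef_eq0 ('X^N - rVpoly u - q).
    rewrite -size_poly_eq0 e /lead_coef e coefB /=.
    move: pm qm; rewrite !monicE /lead_coef ps qs => /eqP -> /eqP ->.
    by rewrite subrr eqxx.
  by apply: orthogonal_uptoD => //; rewrite -scaleN1r; exact: orthogonal_uptoZ.
Qed.

Lemma size_subZ_monic p q m : q \is monic -> size q = m.+1 ->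
  (size p <= m.+1)%N -> (size (p - p`_m *: q)%R <= m)%N.
Proof.
move=> qm qs ps; apply/leq_sizeP => k; rewrite leq_eqVlt => /orP[/eqP <-|mk].
  move: qm; rewrite monicE /lead_coef qs /= => /eqP qm.
  by rewrite !coefE qm mulr1 subrr.
by rewrite !coefE [p`_k]nth_default ?(leq_trans ps)// [q`_k]nth_default ?qs//
  mulr0 subrr.
Qed.

Lemma sqr_XsubC_dvdp (z0 : F) (h : {poly F}) :
  h.[z0] = 0 -> h^`().[z0] = 0 -> exists g, h = ('X - z0%:P) ^+ 2 * g.
Proof.
move=> /eqP/factor_theorem[u ->]; rewrite derivM derivXsubC mulr1.
rewrite !hornerE subrr mulr0 add0r => /eqP/factor_theorem[v ->].
by exists v; rewrite expr2; ring.
Qed.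

(** [W(z0)] is the determinant of the linear system in [(a, b)] which says that [a Q + b P] has a
    double zero at [z0]. *)
Lemma wronskian_root_kernel n (z0 : F) P Q (N := (\sum_i n i)%N) :
  (forall g, (size g <= N)%N -> orthogonal_upto n g -> g = 0) ->
  monic_orthogonal n P -> Q \is monic -> size Q = N.+2 -> orthogonal_upto n Q ->
  (Q * P^`() - Q^`() * P).[z0] = 0 <->
  (exists2 g : {poly F}, g != 0 & (size g <= N)%N /\
     orthogonal_upto n (('X - z0%:P) ^+ 2 * g)).
Proof.
move=> triv [Pm Ps Po] Qm Qs Qo; rewrite !hornerE; split.
- move=> W0.
  have main a b : (a != 0) || (b != 0) ->
      a * Q.[z0] + b * P.[z0] = 0 -> a * Q^`().[z0] + b * P^`().[z0] = 0 ->
      exists2 g : {poly F}, g != 0 & (size g <= N)%N /\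
        orthogonal_upto n (('X - z0%:P) ^+ 2 * g).
    move=> ab h0 h1; pose h := a *: Q + b *: P.
    have [||g hE] := @sqr_XsubC_dvdp z0 h.
    - by rewrite /h !hornerE.
    - by rewrite /h derivD !derivZ !hornerE.
    have ho : orthogonal_upto n h.
      by apply: orthogonal_uptoD; exact: orthogonal_uptoZ.
    (* [Q] and [P] are monic of degrees [N + 1] and [N]: if [h] were zero, its two top coefficients
       would force [a = 0] and then [b = 0]. *)
    have hn0 : h != 0.
      apply: contraTneq ab => hz; rewrite negb_or !negbK.
      have := congr1 (fun t : {poly F} => t`_N.+1) hz.
      rewrite !coefE [P`_N.+1]nth_default ?Ps// mulr0 addr0.
      move: (Qm); rewrite monicE /lead_coef Qs /= => /eqP ->.
      rewrite mulr1 => a0; rewrite a0 eqxx /=.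
      have := congr1 (fun t : {poly F} => t`_N) hz.
      rewrite !coefE a0 mul0r add0r.
      by move: (Pm); rewrite monicE /lead_coef Ps /= => /eqP ->; rewrite mulr1 => ->.
    have hs : (size h <= N.+2)%N.
      rewrite (leq_trans (size_polyD _ _))// geq_max.
      by rewrite !(leq_trans (size_scale_leq _ _)) ?Ps ?Qs.
    have gn0 : g != 0 by apply: contraNneq hn0 => g0; rewrite hE g0 mulr0.
    exists g => //; split; last by rewrite -hE.
    move: hs; rewrite hE size_monicM ?monic_exp ?monicXsubC//.
    by rewrite size_exp_XsubC.
  (* The pair [(P(z0), - Q(z0))] kills the value, and also the derivative because [W(z0) = 0]. If
     this pair is zero, every pair kills the value, and [(P'(z0), - Q'(z0))] or, when [P'(z0) = 0],
     [(0, 1)] kills the derivative. *)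
  have [P0|P0] := eqVneq P.[z0] 0; last first.
    by apply: (main P.[z0] (- Q.[z0])); rewrite ?P0//;
      [ring | rewrite -[RHS]oppr0 -W0; ring].
  have [Q0|Q0] := eqVneq Q.[z0] 0; last first.
    by apply: (main P.[z0] (- Q.[z0])); rewrite ?oppr_eq0 ?Q0 ?orbT//;
      [ring | rewrite -[RHS]oppr0 -W0; ring].
  have [P'0|P'0] := eqVneq P^`().[z0] 0.
    by apply: (main 0 1); rewrite ?oner_neq0 ?orbT ?P0 ?P'0//; ring.
  by apply: (main P^`().[z0] (- Q^`().[z0])); rewrite ?P'0 ?P0 ?Q0//; ring.
- move=> [g gn0 [gs go]]; set h := _ * g in go.
  have gs2 : (size h <= N.+2)%N.
    by rewrite size_monicM ?monic_exp ?monicXsubC// size_exp_XsubC.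
  (* Subtracting multiples of [Q] and then of [P] removes the coefficients of degrees [N + 1] and
     [N]; [triv] kills the orthogonal remainder. *)
  pose a := h`_N.+1; pose h1 := h - a *: Q; pose b := h1`_N.
  have h1s : (size h1 <= N.+1)%N by exact: size_subZ_monic.
  have h2s : (size (h1 - b *: P)%R <= N)%N by exact: size_subZ_monic.
  have h2 : h1 - b *: P = 0.
    apply: triv => //; rewrite /h1 -!scaleNr.
    apply: orthogonal_uptoD; last exact: orthogonal_uptoZ.
    by apply: orthogonal_uptoD => //; exact: orthogonal_uptoZ.
  have hE : h = a *: Q + b *: P.
    by apply/eqP; rewrite -subr_eq0 opprD addrA -/h1 h2.
  have hn0 : h != 0 by rewrite mulf_neq0// expf_neq0// polyXsubC_eq0.
  have e0 : a * Q.[z0] + b * P.[z0] = 0.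
    by rewrite -!hornerZ -hornerD -hE /h !hornerE subrr expr0n !mul0r.
  have e1 : a * Q^`().[z0] + b * P^`().[z0] = 0.
    rewrite -!hornerZ -!derivZ -hornerD -derivD -hE /h expr2 !derivM derivXsubC.
    by rewrite !mul1r !mulr1 !(hornerXsubC, hornerM, hornerD) subrr; ring.
  have : (a != 0) || (b != 0).
    apply: contraNT hn0; rewrite negb_or !negbK => /andP[/eqP a0 /eqP b0].
    by rewrite hE a0 b0 !scale0r addr0.
  (* Cramer's rule: [a W(z0)] and [b W(z0)] are combinations of the left sides of [e0] and [e1]. *)
  case/orP => [a0|b0].
    apply: (mulfI a0); rewrite mulr0.
    transitivity ((a * Q.[z0] + b * P.[z0]) * P^`().[z0]
      - (a * Q^`().[z0] + b * P^`().[z0]) * P.[z0]); first by ring.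
    by rewrite e0 e1 !mul0r subrr.
  apply: (mulfI b0); rewrite mulr0.
  transitivity (Q.[z0] * (a * Q^`().[z0] + b * P^`().[z0])
    - Q^`().[z0] * (a * Q.[z0] + b * P.[z0])); first by ring.
  by rewrite e0 e1 !mulr0 subrr.
Qed.

End Orthogonality.

(** * Signs between real roots and Lagrange interpolation *)

Section RealRootedPolynomials.
Local Set Implicit Arguments.
Local Unset Strict Implicit.

Lemma simple_rootP (F : fieldType) (p : {poly F}) (x : F) :
  p != 0 -> root p x -> (mup x p == 1%N) = (p^`().[x] != 0).
Proof.
move=> p0 px; have m1 : (0 < mup x p)%N by rewrite -XsubC_dvd// dvdp_XsubCl.
rewrite eqn_leq m1 andbT mup_leq//; apply/idP/idP.
  apply: contraNN => /eqP p'0; move/eqP: px => px.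
  by have [g ->] := sqr_XsubC_dvdp px p'0; rewrite dvdp_mulr.
apply: contraNN => /dvdpP[g ->]; apply/eqP.
rewrite expr2 mulrA !derivM derivXsubC.
by rewrite !(hornerXsubC, hornerM, hornerD) !subrr !mulr0 !mul0r addr0.
Qed.

Context {R : rcfType}.
Implicit Types (f g p q h : {poly R}) (s : seq R).

Lemma same_sign_between g (a b : R) : a <= b ->
  (forall x, a <= x <= b -> ~~ root g x) -> 0 < g.[a] * g.[b].
Proof.
move=> ab gN; rewrite ltNge; apply/negP => /(polyrcf.poly_ivt ab)[x xab gx].
by rewrite in_itv /= in xab; move: (gN x xab); rewrite gx.
Qed.

(** With [f = h (X - b) (X - a)], the derivatives at [a] and [b] are [h(a) (a - b)] and
    [h(b) (b - a)], and [h] has no zero on the closed interval. *)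
Lemma derive_signs_between f (a b : R) : a < b -> root f a -> root f b ->
  (forall x, a < x < b -> ~~ root f x) -> f^`().[a] != 0 -> f^`().[b] != 0 ->
  f^`().[a] * f^`().[b] < 0.
Proof.
move=> ab /factor_theorem[u ->] fb fN.
have : root u b by move: fb; rewrite rootM root_XsubC (gt_eqF ab) orbF.
case/factor_theorem => h uE; move: fN; rewrite uE => fN.
rewrite !derivM !derivXsubC !(hornerXsubC, hornerM, hornerD) !hornerC.
rewrite !subrr !mulr0 !mulr1 !add0r !addr0 => ha hb.
have : 0 < h.[a] * h.[b].
  apply: same_sign_between (ltW ab) _ => x /andP[ax xb].
  have [xa|xNa] := eqVneq x a.
    by rewrite xa; apply: contraNN ha => /eqP ->; rewrite mul0r.
  have [xb'|xNb] := eqVneq x b.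
    by rewrite xb'; apply: contraNN hb => /eqP ->; rewrite !mul0r.
  have := fN x; rewrite !lt_neqAle ax xb xNb eq_sym xNa => /(_ isT).
  by rewrite !rootM !root_XsubC !negb_or => /andP[/andP[]].
move=> hab; rewrite (_ : _ * _ = - (h.[a] * h.[b] * (b - a) ^+ 2)); last by ring.
by rewrite oppr_lt0 mulr_gt0// exprn_gt0// subr_gt0.
Qed.

(** Induction on the number of entries of [s] strictly between [a] and [b]; splitting at a root [c]
    lowers it on both sides. *)
Lemma consecutive_roots_ind (f : {poly R}) s (T : R -> R -> Prop) :
  (forall x, root f x = (x \in s)) ->
  (forall a b, a < b -> root f a -> root f b ->
     (forall c, a < c < b -> ~~ root f c) -> T a b) ->
  (forall a c b, a < c < b -> root f a -> root f b -> root f c ->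
     T a c -> T c b -> T a b) ->
  forall a b, a < b -> root f a -> root f b -> T a b.
Proof.
move=> fs Tcons Ttrans a b.
have [m] := ubnP (count (fun x => a < x < b) s).
elim: m a b => // m IH a b; rewrite ltnS => cm ab fa fb.
have [/hasP[c cs cab]|/hasPn noc] := boolP (has (fun x => a < x < b) s); last first.
  by apply: Tcons => // c cab; apply/negP; rewrite fs => /noc; rewrite cab.
have /andP[ac cb] := cab.
have fc : root f c by rewrite fs.
have lt (P : pred R) : subpred P (fun x => a < x < b) -> ~~ P c ->
    (count P s < m)%N.
  move=> sub Pc; apply: leq_trans cm.
  have cpos : (0 < count (pred1 c) s)%N by rewrite -has_count has_pred1.
  apply: (@leq_trans (count P s + count (pred1 c) s)); first by rewrite -addn1 leq_add2l.
  rewrite -count_predUI (@eq_count _ (predI P (pred1 c)) pred0).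
    rewrite count_pred0 addn0; apply: sub_count => x /= /orP[/sub//|/eqP -> //].
  by move=> x /=; apply/negP => /andP[Px /eqP xc]; rewrite -xc Px in Pc.
apply: (Ttrans a c b) => //; apply: IH => //; apply: lt => [x /andP[x1 x2]|].
- by rewrite x1 (lt_trans x2).
- by rewrite ltxx andbF.
- by rewrite x2 (lt_trans ac).
- by rewrite ltxx.
Qed.

(** The Lagrange basis polynomial of the node [x], before normalisation. *)
Definition lagrange_prod s (x : R) : {poly R} :=
  \prod_(y <- rem x s) ('X - y%:P).

Lemma lagrange_prodE s x : x \in s ->
  \prod_(y <- s) ('X - y%:P) = ('X - x%:P) * lagrange_prod s x.
Proof. by move=> xs; rewrite (perm_big _ (perm_to_rem xs)) big_cons. Qed.

Lemma lagrange_prod_eq0 s x z : uniq s ->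
  ((lagrange_prod s x).[z] == 0) = (z != x) && (z \in s).
Proof. by move=> us; rewrite -[LHS]rootE root_prod_XsubC mem_rem_uniq. Qed.

Lemma lagrange_interpolation s f : uniq s -> (size f <= size s)%N ->
  f = \sum_(x <- s)
    (f.[x] / (lagrange_prod s x).[x]) *: lagrange_prod s x.
Proof.
move=> us fs; apply/eqP; rewrite -subr_eq0; apply/eqP.
apply: (@roots_geq_poly_eq0 _ _ s) => //.
  apply/allP => x xs; rewrite rootE !hornerE horner_sum (bigD1_seq x)//=.
  rewrite big1_seq => [|y /andP[yx ys]]; last first.
    rewrite hornerZ (_ : _.[x] = 0) ?mulr0//; apply/eqP.
    by rewrite lagrange_prod_eq0// eq_sym yx.
  by rewrite hornerZ divfK ?addr0 ?subrr// lagrange_prod_eq0// eqxx.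
rewrite (leq_trans (size_polyD _ _))// geq_max fs size_polyN /=.
rewrite (leq_trans (size_sum _ _ _))//; apply/bigmax_leqP_seq => x xs _.
rewrite (leq_trans (size_scale_leq _ _))// size_prod_XsubC size_rem//.
by case: (s) xs.
Qed.

Lemma wronskian_lagrange_prod s x : x \in s ->
  let q := \prod_(y <- s) ('X - y%:P) in let l := lagrange_prod s x in
  q * l^`() - q^`() * l = - l ^+ 2.
Proof. by move=> xs /=; rewrite (lagrange_prodE xs) derivM derivXsubC; ring. Qed.

(** The Wronskian is linear in [f], so it is evaluated on each Lagrange basis polynomial. *)
Lemma wronskian_lagrange s f : uniq s -> (size f <= size s)%N ->
  let q := \prod_(y <- s) ('X - y%:P) in
  q * f^`() - q^`() * f =
  - \sum_(x <- s) (f.[x] / (lagrange_prod s x).[x]) *: lagrange_prod s x ^+ 2.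
Proof.
move=> us fs q; rewrite {1 2}(lagrange_interpolation us fs).
rewrite raddf_sum /= !mulr_sumr -sumrB -sumrN !big_seq.
apply: eq_bigr => x xs; rewrite derivZ -!scalerAr -scalerBr.
by rewrite wronskian_lagrange_prod// scalerN.
Qed.

End RealRootedPolynomials.

(** * Separation of zeros and the real zeros of the Wronskian *)

Section Interlacing.
Local Set Implicit Arguments.
Local Unset Strict Implicit.
Context {R : realType}.
Implicit Types (f g p q : {poly R}) (s : seq R).

Lemma complexify_prod s :
  complexify (\prod_(x <- s) ('X - x%:P)) = \prod_(x <- s) ('X - (x%:C)%:P).
Proof. by rewrite /complexify map_prod_XsubC. Qed.

Lemma real_rooted_prod p : p \is monic -> real_rooted p ->
  exists s, p = \prod_(x <- s) ('X - x%:P).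
Proof.
move=> pm preal.
have [zs zsE] := closed_field_poly_normal (complexify p).
have Pm : complexify p \is monic by rewrite map_monic.
rewrite (monicP Pm) scale1r in zsE.
have zsreal z : z \in zs -> z = (complex.Re z)%:C.
  by rewrite -root_prod_XsubC -zsE => /preal[x ->].
exists (map (@complex.Re R) zs).
apply: (@map_poly_inj _ _ (real_complex R)); rewrite -/(complexify p) zsE.
rewrite -/(complexify _) complexify_prod big_map !big_seq.
by apply: eq_bigr => z /zsreal {1}->.
Qed.

(** At a root [x] of [f] the Wronskian is [- f'(x) g(x)]. Between consecutive roots [f'] changes
    sign, so if [g] had no zero there the Wronskian would change sign and vanish somewhere. *)
Lemma wronskian_root_between f g s (a b : R) :
  (forall x, root f x = (x \in s)) ->
  (forall x, (f * g^`() - f^`() * g).[x] != 0) ->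
  a < b -> root f a -> root f b -> exists2 c, a < c < b & root g c.
Proof.
move=> fs w0; move: a b.
apply: (consecutive_roots_ind fs) => [a b ab fa fb fN|a c b /andP[ac cb] _ _ _].
- apply: contrapT => gN.
  have wE x : root f x -> (f * g^`() - f^`() * g).[x] = - (f^`().[x] * g.[x]).
    by move=> /eqP fx; rewrite !hornerE fx; ring.
  have := same_sign_between (ltW ab) (fun x _ => w0 x).
  have [wa wb] := (w0 a, w0 b); rewrite wE// in wa; rewrite wE// in wb.
  rewrite !wE// mulrNN.
  move: wa wb; rewrite !oppr_eq0 !mulf_eq0 !negb_or.
  move=> /andP[f'a ga] /andP[f'b gb].
  have ff := derive_signs_between ab fa fb fN f'a f'b.
  have gg : 0 < g.[a] * g.[b].
    apply: same_sign_between (ltW ab) _ => x /andP[ax xb].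
    have [->//|xNa] := eqVneq x a; have [->//|xNb] := eqVneq x b.
    apply/negP => gx; apply: gN; exists x => //.
    by rewrite !lt_neqAle ax xb xNb eq_sym xNa.
  rewrite (_ : _ * _ * _ = f^`().[a] * f^`().[b] * (g.[a] * g.[b])); last by ring.
  by rewrite pmulr_lgt0// ltNge (ltW ff).
- by move=> [x /andP[ax xc] gx] _; exists x => //; rewrite ax (lt_trans xc).
Qed.

Lemma wronskian_separates f g (sf sg : seq R) :
  (forall x, root f x = (x \in sf)) -> (forall x, root g x = (x \in sg)) ->
  (forall x, (f * g^`() - f^`() * g).[x] != 0) -> separates f g.
Proof.
move=> fs gs w0 a b [ab fa fb fN].
have w0' x : (g * f^`() - g^`() * f).[x] != 0.
  rewrite (_ : _ - _ = - (f * g^`() - f^`() * g)); last by ring.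
  by rewrite hornerN oppr_eq0.
have [c cab gc] := wronskian_root_between fs w0 ab fa fb.
exists c; split; first by rewrite cab gc.
(* With the roles exchanged, two zeros of [g] would enclose a zero of [f] between the consecutive
   roots [a] and [b]. *)
have no_two x y : a < x -> y < b -> root g x -> root g y -> ~ x < y.
  move=> ax yb gx gy xy.
  have [z /andP[xz zy] fz] := wronskian_root_between gs w0' xy gx gy.
  by have := fN z; rewrite fz (lt_trans ax xz) (lt_trans zy yb) => /(_ isT).
move: cab => /andP[ac cb] y /andP[/andP[ay yb] gy].
have [/(no_two _ _ ac yb gc gy)//|/(no_two _ _ ay cb gy gc)//|//] := ltgtP c y.
Qed.

Lemma wronskian_simple_roots f g : f != 0 ->
  (forall x, (f * g^`() - f^`() * g).[x] != 0) -> simple_roots f.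
Proof.
move=> f0 w0 x fx; apply/eqP; rewrite simple_rootP//.
move: (w0 x); rewrite !hornerE (eqP fx) mul0r add0r oppr_eq0 mulf_eq0 negb_or.
by case/andP.
Qed.

Lemma simple_roots_uniq s : simple_roots (\prod_(x <- s) ('X - x%:P)) -> uniq s.
Proof.
move=> simple; apply: count_mem_uniq => x.
have [xs|xNs] := boolP (x \in s); last exact/count_memPn.
have q0 : \prod_(x <- s) ('X - x%:P) != 0 by rewrite monic_neq0// monic_prod_XsubC.
have qx : root (\prod_(x <- s) ('X - x%:P)) x by rewrite root_prod_XsubC.
have /eqP := simple x qx; rewrite simple_rootP// (lagrange_prodE xs).
rewrite derivM derivXsubC hornerD !hornerM hornerXsubC subrr mul0r addr0.
rewrite hornerC mul1r -rootE root_prod_XsubC => /count_memPn.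
by rewrite count_rem /= eqxx xs /=; move: xs; rewrite -has_pred1 has_count;
  case: (count _ _) => [|[]].
Qed.

Lemma interlace_wronskian_neq0 p q : p \is monic -> q \is monic ->
  size q = (size p).+1 -> interlace q p ->
  forall z, (q * p^`() - q^`() * p).[z] != 0.
Proof.
move=> pm qm sqp [[qreal _] [qsimple psimple] ncommon sep _] z.
have [s qE] := real_rooted_prod qm qreal.
have us : uniq s by apply: simple_roots_uniq; rewrite -qE.
have qs x : root q x = (x \in s) by rewrite qE root_prod_XsubC.
have q0 := monic_neq0 qm; have p0 := monic_neq0 pm.
have ps : (size p <= size s)%N.
  by move: sqp; rewrite qE size_prod_XsubC => -[->].
(* At a zero [x] of [q], this has the sign of the coefficient [c x] of the interpolation of [p],
   since [q'(x)] is the value at [x] of its Lagrange product. *)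
pose sg x := p.[x] * q^`().[x].
have q'0 x : root q x -> q^`().[x] != 0.
  by move=> qx; rewrite -simple_rootP//; apply/eqP/qsimple.
have same : forall a b, a < b -> root q a -> root q b -> 0 < sg a * sg b.
  apply: (consecutive_roots_ind qs) => [a b ab qa qb qN|a c b _ _ _ _ h1 h2].
  (* Between consecutive zeros of [q] there is a single, simple zero of [p], so [p] and [q'] both
     change sign and their product does not. *)
  - have [c [/andP[/andP[ac cb] pc] cuniq]] : exists! c, (a < c < b) && root p c.
      by apply: sep; split.
    have qq := derive_signs_between ab qa qb qN (q'0 _ qa) (q'0 _ qb).
    have p'c : p^`().[c] != 0 by rewrite -simple_rootP//; apply/eqP/psimple.
    have /factor_theorem[g gE] := pc.
    have gc : g.[c] != 0.
      move: p'c; rewrite gE derivM derivXsubC hornerD !hornerM hornerXsubC subrr.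
      by rewrite mulr0 add0r hornerC mulr1.
    have gg : 0 < g.[a] * g.[b].
      apply: same_sign_between (ltW ab) _ => x /andP[ax xb]; apply/negP => gx.
      have px : root p x by rewrite gE rootM gx.
      have [xa|xNa] := eqVneq x a; first by move: (ncommon a); rewrite qa -xa px.
      have [xb'|xNb] := eqVneq x b; first by move: (ncommon b); rewrite qb -xb' px.
      have cx : c = x by apply: cuniq; rewrite px !lt_neqAle ax xb xNb eq_sym xNa.
      by move: gc; rewrite cx -rootE gx.
    rewrite /sg gE !hornerM !hornerXsubC.
    rewrite (_ : _ * _ = - (g.[a] * g.[b]) * ((c - a) * (b - c)) *
      (q^`().[a] * q^`().[b])); last by ring.
    rewrite nmulr_lgt0// nmulr_rlt0 ?oppr_lt0//.
    by rewrite mulr_gt0// subr_gt0.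
  - move: (sg a) (sg b) (sg c) h1 h2 => u v t h1 h2.
    have t0 : t != 0 by apply: contraTneq h1 => ->; rewrite mulr0 ltxx.
    have : 0 < (u * t) * (t * v) by rewrite mulr_gt0.
    rewrite (_ : _ * _ = u * v * t ^+ 2); last by ring.
    by rewrite pmulr_lgt0// exprn_even_gt0.
have [x0 x0s] : exists x, x \in s.
  case: (s) ps => [|x s' _]; last by exists x; rewrite inE eqxx.
  by rewrite leqn0 size_poly_eq0 (negbTE p0).
pose c x := p.[x] / (lagrange_prod s x).[x].
have l0 x : x \in s -> (lagrange_prod s x).[x] != 0.
  by move=> xs; rewrite lagrange_prod_eq0// eqxx.
have q'E x : x \in s -> q^`().[x] = (lagrange_prod s x).[x].
  move=> xs; rewrite qE (lagrange_prodE xs) derivM derivXsubC hornerD !hornerM.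
  by rewrite hornerXsubC subrr mul0r addr0 hornerC mul1r.
have cE x : x \in s -> sg x = c x * (lagrange_prod s x).[x] ^+ 2.
  by move=> xs; rewrite /sg /c q'E//; field; exact: l0.
have csame x : x \in s -> 0 < c x0 * c x.
  move=> xs; have : 0 < sg x0 * sg x.
    have [qx0 qx] : root q x0 /\ root q x by rewrite !qs.
    have [x0x|xx0|->] := ltgtP x0 x; first exact: same.
      by rewrite mulrC; exact: same.
    rewrite -expr2 exprn_even_gt0//= mulf_neq0 ?q'0//.
    by move: (ncommon x); rewrite qx.
  rewrite !cE//.
  rewrite (_ : _ * _ = c x0 * c x * ((lagrange_prod s x0).[x0] *
    (lagrange_prod s x).[x]) ^+ 2); last by ring.
  by rewrite pmulr_lgt0// exprn_even_gt0//= mulf_neq0// l0.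
rewrite qE (wronskian_lagrange us ps) hornerN oppr_eq0 horner_sum.
apply/eqP => W0.
(* The factor [c x0] makes all terms nonnegative, so each of them vanishes; but at every [z] some
   Lagrange product is nonzero. *)
have : \sum_(x <- s) c x0 * c x * (lagrange_prod s x).[z] ^+ 2 = 0.
  rewrite -[RHS](mulr0 (c x0)) -[X in _ = _ * X]W0 mulr_sumr.
  by apply: eq_bigr => x _; rewrite hornerZ horner_exp; exact: esym (mulrA _ _ _).
rewrite big_seq => /eqP; rewrite psumr_eq0 => [/allP all0|x xs]; last first.
  by rewrite mulr_ge0 ?sqr_ge0// ltW// csame.
have lz x : x \in s -> (lagrange_prod s x).[z] = 0.
  move=> xs; have := all0 x xs; rewrite xs /= mulf_eq0 gt_eqF ?csame//=.
  by rewrite sqrf_eq0 => /eqP.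
have [zs|zNs] := boolP (z \in s).
  by have := l0 z zs; rewrite lz// eqxx.
by have /eqP := lz x0 x0s; rewrite lagrange_prod_eq0// (negbTE zNs) andbF.
Qed.

End Interlacing.

(** * Real-rootedness from a Wronskian without real zeros *)

Section InterlacingConverse.
Local Set Implicit Arguments.
Local Unset Strict Implicit.
Context {R : realType}.
Implicit Types (f g p q : {poly R}) (s : seq R).

Lemma monic_quotient_linear p q : p \is monic -> q \is monic ->
  size q = (size p).+1 ->
  exists c f, q = ('X - c%:P) * p + f /\ (size f < size p)%N.
Proof.
move=> pm qm sqp; set N := (size p).-1.
have sp : size p = N.+1 by rewrite prednK// size_poly_gt0 monic_neq0.
have Xpm : 'X * p \is monic by rewrite monicMl// monicX.
have sXp : size ('X * p) = N.+2.
  by rewrite size_monicM ?monicX ?monic_neq0// size_polyX sp.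
pose f1 := q - 'X * p.
have f1s : (size f1 <= N.+1)%N.
  rewrite /f1; have := @size_subZ_monic _ q ('X * p) N.+1 Xpm sXp.
  rewrite sqp sp => /(_ (leqnn _)).
  by move: qm; rewrite monicE /lead_coef sqp sp /= => /eqP ->; rewrite scale1r.
(* One more division step: since [p] is monic, this constant cancels the coefficient of degree [N]
   in [f1]. *)
exists (- f1`_N), (f1 - f1`_N *: p); split.
  by rewrite -mul_polyC polyCN /f1; ring.
by rewrite sp ltnS; apply: size_subZ_monic.
Qed.

Lemma wronskian_lead p s (c : R) f : p = \prod_(y <- s) ('X - y%:P) ->
  uniq s -> (size f <= size s)%N ->
  let q := ('X - c%:P) * p + f in
  q * p^`() - q^`() * p = - p ^+ 2 +
  \sum_(y <- s) (f.[y] / (lagrange_prod s y).[y]) *: lagrange_prod s y ^+ 2.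
Proof.
move=> pE us fs q.
have -> : \sum_(y <- s) (f.[y] / (lagrange_prod s y).[y]) *: lagrange_prod s y ^+ 2
    = - (p * f^`() - p^`() * f).
  by rewrite pE (wronskian_lagrange us fs) opprK.
by rewrite /q derivD derivM derivXsubC; ring.
Qed.

(** These weights are the residues of [q / p]. The Wronskian has leading coefficient [-1] and no
    real zero, so it is negative everywhere; at a zero [y] of [p] it equals the weight times a
    nonzero square. *)
Lemma interpolation_weights_lt0 p s (c : R) f :
  p = \prod_(y <- s) ('X - y%:P) -> uniq s -> (size f <= size s)%N ->
  let q := ('X - c%:P) * p + f in
  (forall z, (q * p^`() - q^`() * p).[z] != 0) ->
  forall y, y \in s -> f.[y] / (lagrange_prod s y).[y] < 0.
Proof.
move=> pE us fs q w0 y ys.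
have wE := wronskian_lead c pE us fs; rewrite -/q in wE.
set w := q * _ - _ in w0.
pose k y := f.[y] / (lagrange_prod s y).[y].
pose S := \sum_(y <- s) k y *: lagrange_prod s y ^+ 2.
have pm : p \is monic by rewrite pE monic_prod_XsubC.
have sp : size p = (size s).+1 by rewrite pE size_prod_XsubC.
(* The sum has smaller degree than [p ^+ 2], so it leaves the leading coefficient of [w]
   unchanged. *)
have sizeS : (size S < size (p ^+ 2))%N.
  rewrite expr2 size_monicM ?monic_neq0// sp addnS /=.
  rewrite (leq_ltn_trans (size_sum _ _ _))// ltnS; apply/bigmax_leqP_seq => x xs _.
  rewrite (leq_trans (size_scale_leq _ _))// expr2 size_monicM ?monic_neq0
    ?monic_prod_XsubC// !size_prod_XsubC !size_rem//.
  by case: (s) xs => //= *; lia.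
have lcw : lead_coef (- w) = 1.
  rewrite /w wE opprD opprK lead_coefDl ?size_polyN//.
  by rewrite lead_coef_exp (monicP pm) expr1n.
have [x0 x0P] := poly_pinfty_gt_lc (p := - w) (eq_ind_r (fun t => 0 < t) ltr01 lcw).
have neg : forall z, w.[z] < 0.
  have : w.[x0] < 0.
    by have := x0P x0 (lexx _); rewrite lcw hornerN => h; lra.
  move=> h z; have [zx|xz] := leP z x0.
    by have := same_sign_between zx (fun x _ => w0 x); rewrite nmulr_lgt0.
  by have := same_sign_between (ltW xz) (fun x _ => w0 x); rewrite nmulr_rgt0.
have := neg y; rewrite /w wE hornerD hornerN horner_exp.
have -> : p.[y] = 0 by apply/eqP; rewrite -rootE pE root_prod_XsubC.
rewrite expr0n oppr0 add0r horner_sum (bigD1_seq y)//= big1_seq => [|x /andP[xy xs]].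
  rewrite addr0 hornerZ horner_exp pmulr_llt0// exprn_even_gt0//=.
  by rewrite lagrange_prod_eq0// eqxx.
rewrite hornerZ horner_exp (_ : (lagrange_prod s x).[y] = 0) ?expr0n ?mulr0//.
by apply/eqP; rewrite lagrange_prod_eq0// eq_sym xy.
Qed.

(* With [q = (X - c) p + sum_y k_y l_y] and [k_y < 0], the imaginary part of
   [q(z) conj (p z)] is [Im z (|p z|^2 - sum_y k_y |l_y z|^2)], which vanishes
   only for real [z] once [p z] is nonzero. *)
Lemma wronskian_real_rooted p q : p \is monic -> q \is monic ->
  size q = (size p).+1 -> real_rooted p ->
  (forall z, (q * p^`() - q^`() * p).[z] != 0) -> real_rooted q.
Proof.
move=> pm qm sqp preal w0 z qz.
have [s pE] := real_rooted_prod pm preal.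
have us : uniq s.
  apply: simple_roots_uniq; rewrite -pE.
  apply: (@wronskian_simple_roots _ p q) => [|x]; first exact: monic_neq0.
  rewrite (_ : _ - _ = - (q * p^`() - q^`() * p)); last by ring.
  by rewrite hornerN oppr_eq0.
have [c [f [qE fs]]] := monic_quotient_linear pm qm sqp.
have fs' : (size f <= size s)%N by move: fs; rewrite pE size_prod_XsubC ltnS.
pose k y := f.[y] / (lagrange_prod s y).[y].
have k0 : forall y, y \in s -> k y < 0.
  by apply: (interpolation_weights_lt0 (c := c) pE us fs'); rewrite -qE.
have [/preal//|pz] := boolP (root (complexify p) z).
pose nsq (u : R[i]) : R := complex.Re u ^+ 2 + complex.Im u ^+ 2.
pose l y := (complexify (lagrange_prod s y)).[z].
set Pz := (complexify p).[z].
have PzE y : y \in s -> Pz = (z - y%:C) * l y.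
  move=> ys; rewrite /Pz pE (lagrange_prodE ys) /complexify rmorphM /=.
  by rewrite hornerM map_polyXsubC hornerXsubC.
have fz : (complexify f).[z] = \sum_(y <- s) (k y)%:C * l y.
  rewrite {1}(lagrange_interpolation us fs') /complexify rmorph_sum horner_sum.
  by apply: eq_bigr => y _; rewrite /= map_polyZ hornerZ.
have Qz : (z - c%:C) * Pz + \sum_(y <- s) (k y)%:C * l y = 0.
  rewrite -fz -(eqP qz) qE /complexify rmorphD rmorphM /=.
  by rewrite hornerD hornerM map_polyXsubC hornerXsubC.
have : complex.Im (((z - c%:C) * Pz + \sum_(y <- s) (k y)%:C * l y) * Pz^*) = 0.
  by rewrite Qz mul0r.
rewrite mulrDl mulr_suml raddfD raddf_sum /=.
have -> : complex.Im ((z - c%:C) * Pz * Pz^*) = complex.Im z * nsq Pz.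
  by rewrite /nsq; case: (z) (Pz) => a b [u v] /=; ring.
(* By [PzE], [l y * Pz^*] is the conjugate of [z - y] times [|l y|^2], with imaginary part
   [- Im z |l y|^2]. *)
have -> : \sum_(y <- s) complex.Im ((k y)%:C * l y * Pz^*) =
    \sum_(y <- s) complex.Im z * (- k y * nsq (l y)).
  rewrite !big_seq; apply: eq_bigr => y ys; rewrite (PzE _ ys) /nsq.
  by case: (z) (l y) => a b [u v] /=; ring.
rewrite -mulr_sumr -mulrDr => /eqP; rewrite mulf_eq0 => /orP[/eqP bz|].
  by exists (complex.Re z); move: bz; case: (z) => a b /= ->.
rewrite gt_eqF// ltr_wpDr//.
  rewrite big_seq; apply: sumr_ge0 => y ys; apply: mulr_ge0.
    by rewrite oppr_ge0 ltW// k0.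
  by rewrite addr_ge0// sqr_ge0.
rewrite /nsq lt_neqAle addr_ge0 ?sqr_ge0// andbT eq_sym paddr_eq0 ?sqr_ge0//.
rewrite !sqrf_eq0; apply: contraNN pz => /andP[/eqP h1 /eqP h2].
by rewrite rootE -/Pz eq_complex h1 h2 !eqxx.
Qed.

Lemma interlace_wronskianP p q : p \is monic -> q \is monic ->
  size q = (size p).+1 -> real_rooted p ->
  interlace q p <-> (forall z, (q * p^`() - q^`() * p).[z] != 0).
Proof.
move=> pm qm sqp preal; split; first exact: interlace_wronskian_neq0.
move=> w0.
have w0' z : (p * q^`() - p^`() * q).[z] != 0.
  rewrite (_ : _ - _ = - (q * p^`() - q^`() * p)); last by ring.
  by rewrite hornerN oppr_eq0.
have qreal := wronskian_real_rooted pm qm sqp preal w0.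
have [sp pE] := real_rooted_prod pm preal.
have [sq qE] := real_rooted_prod qm qreal.
have ps x : root p x = (x \in sp) by rewrite pE root_prod_XsubC.
have qs x : root q x = (x \in sq) by rewrite qE root_prod_XsubC.
split => //.
- by split; apply: wronskian_simple_roots (monic_neq0 _) _; eassumption.
- move=> x; apply: contraNN (w0 x) => /andP[/eqP qx /eqP px].
  by rewrite !hornerE qx px; apply/eqP; ring.
- exact: wronskian_separates qs ps w0.
- exact: wronskian_separates ps qs w0'.
Qed.

End InterlacingConverse.

(** * Normality as triviality of a kernel *)

Section IntegralForms.
Local Set Implicit Arguments.
Local Unset Strict Implicit.

(** Carrying the proof of finite moments in the term lets the linear structure be declared as an
    instance. *)
Definition integral_form (R : realType) (mu : complex_measure R)
  & finite_moments mu := poly_integral mu.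

Fact integral_form_is_linear (R : realType) (mu : complex_measure R)
  (hmu : finite_moments mu) : scalar (integral_form hmu).
Proof. by move=> a p q; rewrite /integral_form poly_integralD// poly_integralZ. Qed.

HB.instance Definition _ (R : realType) (mu : complex_measure R)
    (hmu : finite_moments mu) :=
  GRing.isLinear.Build _ _ _ _ (integral_form hmu) (integral_form_is_linear hmu).

Definition weighted_form (F : fieldType) (w : {poly F}) (L : {scalar {poly F}}) p :=
  L (w * p).

Fact weighted_form_is_linear (F : fieldType) (w : {poly F}) (L : {scalar {poly F}}) :
  scalar (weighted_form w L).
Proof.
by move=> a p q; rewrite /weighted_form mulrDr -scalerAr linearD linearZ.
Qed.

HB.instance Definition _ (F : fieldType) (w : {poly F}) (L : {scalar {poly F}}) :=
  GRing.isLinear.Build _ _ _ _ (weighted_form w L) (weighted_form_is_linear w L).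

Context {R : realType} {r : nat}.
Implicit Types (mu : 'I_r -> complex_measure R) (L : 'I_r -> {scalar {poly R[i]}})
  (n : 'I_r -> nat) (P Q g : {poly R[i]}).

Lemma typeIIE mu L n P : (forall i p, L i p = poly_integral (mu i) p) ->
  typeII mu n P <-> monic_orthogonal L n P.
Proof.
move=> LE; have e i k : complex_integral (mu i) (fun x => P.[x%:C] * x%:C ^+ k) =
    L i (P * 'X^k).
  rewrite LE /poly_integral; congr complex_integral.
  by apply/funext => x; rewrite !hornerE.
by split=> -[Pm Ps Po]; split=> // i k ki; [rewrite -e | rewrite e]; exact: Po.
Qed.

Lemma normal_kernelP mu L n : (forall i p, L i p = poly_integral (mu i) p) ->
  normal mu n <->
  (forall g, (size g <= \sum_i n i)%N -> orthogonal_upto L n g -> g = 0).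
Proof.
move=> LE; rewrite -monic_orthogonal_uniqueP; split=> -[P [hP uP]]; exists P.
  by split=> [|Q hQ]; [exact/(typeIIE _ _ LE) | exact/uP/(typeIIE _ _ LE)].
by split=> [|Q hQ]; [exact/(typeIIE _ _ LE) | exact/uP/(typeIIE _ _ LE)].
Qed.

(** The weight moves from the measure to the polynomial, so the kernel criterion applies to the
    functionals [p |-> L i ((X - z0)^2 p)]. *)
Lemma normal_weighted_kernelP mu (hmu : forall i, finite_moments (mu i)) L n
    (z0 : R[i]) : (forall i p, L i p = poly_integral (mu i) p) ->
  normal (fun i => weighted_measure (hmu i) z0) n <->
  (forall g, (size g <= \sum_i n i)%N ->
     orthogonal_upto L n (('X - z0%:P) ^+ 2 * g) -> g = 0).
Proof.
move=> LE; pose Lw i : {scalar {poly R[i]}} := weighted_form (('X - z0%:P) ^+ 2) (L i).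
have LwE i p : Lw i p = L i (('X - z0%:P) ^+ 2 * p) by [].
have hLw i p : Lw i p = poly_integral (weighted_measure (hmu i) z0) p.
  by rewrite LwE LE poly_integral_weighted.
clearbody Lw.
rewrite (normal_kernelP _ hLw); split=> h g gs go; apply: h => // i k ki.
  by rewrite LwE mulrA; exact: go.
by have := go i k ki; rewrite LwE mulrA.
Qed.

Lemma sum_add_unit n j : (\sum_i add_unit n j i = (\sum_i n i).+1)%N.
Proof.
rewrite /add_unit big_split /= -addn1; congr (_ + _)%N.
by rewrite (bigD1 j)//= eqxx big1 ?addn0// => i /negbTE ->.
Qed.

Lemma normal_weighted_wronskianP mu (hmu : forall i, finite_moments (mu i)) n j
    P Q (z0 : R[i]) :
  normal mu n -> typeII mu n P -> typeII mu (add_unit n j) Q ->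
  ~ normal (fun i => weighted_measure (hmu i) z0) n <->
  (Q * P^`() - Q^`() * P).[z0] = 0.
Proof.
pose L i : {scalar {poly R[i]}} := integral_form (hmu i).
have LE i p : L i p = poly_integral (mu i) p by [].
clearbody L.
move=> /(normal_kernelP _ LE) triv /(typeIIE _ _ LE) hP /(typeIIE _ _ LE)[Qm Qs Qo].
rewrite sum_add_unit in Qs.
(* The conditions at [n] are among those at [n + e_j]. *)
have Qo' : orthogonal_upto L n Q.
  by move=> i k ki; apply: Qo; rewrite /add_unit (leq_trans ki)// leq_addr.
rewrite (wronskian_root_kernel z0 triv hP Qm Qs Qo').
rewrite (normal_weighted_kernelP hmu _ z0 LE).
split=> [h|[g g0 [gs go]] h]; last by rewrite (h g gs go) eqxx in g0.
apply: contrapT => nog; apply: h => g gs go; apply/eqP; apply: contrapT => g0.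
by apply: nog; exists g => //; exact/negP.
Qed.

End IntegralForms.


Theorem theorem5p1 (R : realType) (r : nat) (hr : (1 <= r)%N)
    (mu : 'I_r -> complex_measure R) (hmu : forall i, finite_moments (mu i))
    (n : 'I_r -> nat) (j : 'I_r)
    (hn : normal mu n) (hnj : normal mu (add_unit n j))
    (P Q : {poly R[i]})
    (hP : typeII mu n P) (hQ : typeII mu (add_unit n j) Q) :
  let W := Q * P^`() - Q^`() * P in
  [set z0 : R[i] | W.[z0] = 0] =
    [set z0 : R[i] | ~ normal (fun i => weighted_measure (hmu i) z0) n]
  /\
  (forall p q : {poly R}, P = complexify p -> Q = complexify q ->
     real_rooted p ->
     (interlace q p <->
      forall z0 : R, normal (fun i => weighted_measure (hmu i) z0%:C) n)).
Proof.
move=> W; have WP z0 := normal_weighted_wronskianP hmu z0 hn hP hQ.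
split=> [|p q Pp Qq preal].
  by apply/seteqP; split=> z0 /WP.
have pm : p \is monic.
  by have [+ _ _] := hP; rewrite Pp /complexify map_monic.
have qm : q \is monic.
  by have [+ _ _] := hQ; rewrite Qq /complexify map_monic.
have sqp : size q = (size p).+1.
  have [_ sP _] := hP; have [_ sQ _] := hQ.
  move: sP sQ; rewrite Pp Qq /complexify !size_map_poly => -> ->.
  by rewrite sum_add_unit.
(* At real points [W] is the real Wronskian, so interlacing becomes the absence of real zeros of
   [W]. *)
have Wreal (z : R) : W.[z%:C] = ((q * p^`() - q^`() * p).[z])%:C.
  by rewrite /W Pp Qq /complexify !deriv_map -!rmorphM -rmorphB horner_map.
rewrite (interlace_wronskianP pm qm sqp preal); split=> w0 z.
  apply: contrapT => /WP; rewrite -/W Wreal => /eqP.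
  by rewrite -[0](rmorph0 (real_complex R)) (inj_eq (@complexI R)) (negbTE (w0 z)).
apply/eqP => wz; have /WP : W.[z%:C] = 0 by rewrite Wreal wz.
by apply; exact: w0.
Qed.
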